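(* Assume the standing setting and assumption in the context. There exist constants $C_7,C_8,C_9,C_3'>0$ such that for any Borel set $B\subset\mathbb R$ with $\mu(B)>0$ there exists $N\in\mathbb N$ such that for all $s>C_7$, $$\mathbb P\Big(\sup_{x\in\mathbb Z^d:\,|x|_1\ge N}\ \max_{\pi\in\mathrm{Geo}(0,x)}\nu^\pi(B) > s\,\mu(B)^{1/d}\Big)\ \le\ C_8 e^{-C_9 s}.$$ Moreover, $$\mathbb E\Big[\sup_{x\in\mathbb Z^d:\,|x|_1\ge N}\ \max_{\pi\in\mathrm{Geo}(0,x)}\nu^\pi(B)\Big]\ \le\ C_3'\,\mu(B)^{1/d}.$$
   Context: Setting: $d\ge2$; $\mathcal E^d$ nearest-neighbor edges of $\mathbb Z^d$; $\{\tau_e\}$ i.i.d. non-negative with law $\mu$, distribution function $F$, essential infimum $r$. Standing assumption: $F(r)<p_c(d)$ if $r=0$ and $F(r)<\vec p_c(d)$ if $r>0$ ($p_c(d)$, $\vec p_c(d)$: critical probabilities of Bernoulli bond and oriented bond percolation on $\mathbb Z^d$). $T(\gamma)=\sum_{e\in\gamma}\tau_e$; $T(x,y)$ is the infimum over vertex self-avoiding paths from $x$ to $y$; a geodesic attains it; $\mathrm{Geo}(0,x)$ is the set of geodesics from $0$ to $x$. For a geodesic $\pi$ with $|\pi|$ edges, $\nu^\pi(B)=\frac1{|\pi|}\#\{e\in\pi:\tau_e\in B\}$. *)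

(* Defs.v *)
From HB Require Import structures.
From mathcomp Require Import all_boot all_order all_algebra.
From mathcomp Require Import all_classical all_reals.
From mathcomp Require Import topology normedtype sequences exp measure
  lebesgue_measure lebesgue_integral probability.

Set Implicit Arguments.
Unset Strict Implicit.
Unset Printing Implicit Defensive.

Import Order.TTheory GRing.Theory Num.Theory.
Local Open Scope classical_set_scope.
Local Open Scope ring_scope.

Definition vertex (d : nat) := 'rV[int]_d.

Definition unitv (d : nat) (i : 'I_d) : vertex d := delta_mx 0 i.

Definition norm1 (d : nat) (x : vertex d) : nat := (\sum_(i < d) `|x ord0 i|%N)%N.

(* An edge {x, x + e_i} of E^d is represented canonically by the pair (x, i);
   this is a bijection between vertex d * 'I_d and E^d. *)
Definition edge (d : nat) := (vertex d * 'I_d)%type.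

Definition adj (d : nat) (u v : vertex d) : bool :=
  [exists i : 'I_d, (v == u + unitv i) || (u == v + unitv i)].

Definition edge_of (d : nat) (u v : vertex d) : option (edge d) :=
  match [pick i : 'I_d | v == u + unitv i] with
  | Some i => Some (u, i)
  | None => match [pick i : 'I_d | u == v + unitv i] with
            | Some i => Some (v, i)
            | None => None
            end
  end.

(* A path is the vertex sequence x :: s.  It is a vertex self-avoiding
   path from x to y when consecutive vertices are adjacent, it ends at y,
   and no vertex is repeated.  Its number of edges |pi| is size s. *)
Definition is_spath (d : nat) (x y : vertex d) (s : seq (vertex d)) : bool :=
  [&& path (@adj d) x s, last x s == y & uniq (x :: s)].

Definition path_edges (d : nat) (x : vertex d) (s : seq (vertex d)) : seq (edge d) :=
  pmap id (pairmap (@edge_of d) x s).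

Section Proba.
Context {R : realType}.

Definition iid_indep (d : nat) {dO : measure_display} {Omega : measurableType dO}
  (P : probability Omega R) (tau : edge d -> Omega -> R) : Prop :=
  forall (s : seq (edge d)), uniq s ->
  forall A : edge d -> set R, (forall e, measurable (A e)) ->
  P (\bigcap_(e in [set` s]) (tau e @^-1` A e)) =
  (\prod_(e <- s) P (tau e @^-1` A e))%E.

Definition events_indep (d : nat) {dO : measure_display} {Omega : measurableType dO}
  (P : probability Omega R) (O : edge d -> set Omega) : Prop :=
  forall (s : seq (edge d)), uniq s ->
  P (\bigcap_(e in [set` s]) O e) = (\prod_(e <- s) P (O e))%E.

(* i.i.d. Bernoulli(p) bond configuration: O e = event "edge e is open" *)
Definition bernoulli_bond (d : nat) (p : R) {dO : measure_display}
  {Omega : measurableType dO} (P : probability Omega R) (O : edge d -> set Omega) : Prop :=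
  (forall e, measurable (O e)) /\ (forall e, P (O e) = p%:E) /\ events_indep P O.

(* the open cluster of 0 is infinite: for every n there is an open
   (self-avoiding) path from 0 to some x with |x|_1 >= n *)
Definition percolates_at (d : nat) {dO : measure_display} {Omega : measurableType dO}
  (O : edge d -> set Omega) : set Omega :=
  [set w | forall n : nat, exists (x : vertex d) (s : seq (vertex d)),
     [/\ (n <= norm1 x)%N, is_spath 0 x s & forall e, e \in path_edges 0 s -> O e w]].

Definition oadj (d : nat) (u v : vertex d) : bool :=
  [exists i : 'I_d, v == u + unitv i].

(* infinitely many vertices reachable from 0 by oriented open paths *)
Definition opercolates_at (d : nat) {dO : measure_display} {Omega : measurableType dO}
  (O : edge d -> set Omega) : set Omega :=
  [set w | forall n : nat, exists (x : vertex d) (s : seq (vertex d)),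
     [/\ (n <= norm1 x)%N, path (@oadj d) 0 s, last 0 s = x &
         forall e, e \in path_edges 0 s -> O e w]].

Definition no_perc (d : nat) (p : R) : Prop :=
  forall (dO : measure_display) (Omega : measurableType dO)
    (P : probability Omega R) (O : edge d -> set Omega),
  bernoulli_bond p P O -> P (percolates_at O) = 0%E.

Definition no_operc (d : nat) (p : R) : Prop :=
  forall (dO : measure_display) (Omega : measurableType dO)
    (P : probability Omega R) (O : edge d -> set Omega),
  bernoulli_bond p P O -> P (opercolates_at O) = 0%E.

Definition p_c (d : nat) : R := sup [set p : R | 0 <= p <= 1 /\ no_perc d p].
Definition op_c (d : nat) : R := sup [set p : R | 0 <= p <= 1 /\ no_operc d p].

Definition distF (mu : probability R R) (t : R) : R := fine (mu `]-oo, t]%classic).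
Definition ess_inf_law (mu : probability R R) : R :=
  sup [set t : R | mu `]-oo, t[%classic = 0%E].

Section FPP.
Variables (d : nat) (dO : measure_display) (Omega : measurableType dO)
  (tau : edge d -> Omega -> R).

Definition Tpath (w : Omega) (x : vertex d) (s : seq (vertex d)) : R :=
  \sum_(e <- path_edges x s) tau e w.

Definition Tpp (w : Omega) (x y : vertex d) : R :=
  inf [set Tpath w x s | s in [set s | is_spath x y s]].

Definition Geo (w : Omega) (x : vertex d) : set (seq (vertex d)) :=
  [set s | is_spath 0 x s /\ Tpath w 0 s = Tpp w 0 x].

Definition nu (w : Omega) (B : set R) (s : seq (vertex d)) : R :=
  (count (fun e => `[< B (tau e w) >]) (path_edges 0 s))%:R / (size s)%:R.

Definition sup_nu (B : set R) (N : nat) (w : Omega) : R :=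
  sup [set sup [set nu w B s | s in Geo w x] | x in [set x : vertex d | (N <= norm1 x)%N]].

End FPP.
End Proba.

(* Main.v *)
(* The geodesic property plays no role: a geodesic from 0 to x with |x|_1 >= N is
   a self-avoiding path with n >= N edges, so it suffices to bound, for p = mu(B),
   the largest number of edges with weight in B on such paths.  Cut Z^d into boxes
   of side L ~ p^(-1/d).  A path of n edges is contained in the 3^d-neighbourhoods
   of a chain of K + 1 ~ n / L boxes with steps in {-1,0,1}^d; there are at most
   3^(d K) chains, each covers O(K L^d) = O(K / p) edges, and the number of
   B-edges among these has mean O(K) and an exponential tail.  Hence outside an
   event of probability 2^-K0 all paths of n >= K0 L edges carry at most
   O(K) = O(n p^(1/d)) B-edges.
   As N may depend on B, K0 can be chosen so large that 2^-K0 is at most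
   exp(-p^(-1/d)); this gives the tail bound for s < p^(-1/d), while for
   s >= p^(-1/d) the event is empty because the frequencies are at most 1. *)

Require Import Defs.
From HB Require Import structures.
From mathcomp Require Import all_boot all_order all_algebra.
From mathcomp Require Import all_classical all_reals.
From mathcomp Require Import topology normedtype sequences exp measure
  lebesgue_measure lebesgue_integral probability.
From mathcomp Require Import numfun measurable_realfun zify ring lra.
Import Order.TTheory GRing.Theory Num.Theory.
Local Open Scope classical_set_scope.
Local Open Scope ring_scope.

(** * Edges of a self-avoiding path *)

Section PathEdges.
Context {d : nat}.
Implicit Types (x y u v : vertex d) (s : seq (vertex d)).

Lemma edge_ofP u v e : edge_of u v = Some e ->
  (e.1 = u /\ v = u + unitv e.2) \/ (e.1 = v /\ u = v + unitv e.2).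
Proof.
rewrite /edge_of; case: pickP => [i /eqP -> [<-]|_]; first by left.
by case: pickP => [i /eqP -> [<-]|//]; right.
Qed.

Lemma path_edges_cons x y s : path_edges x (y :: s) =
  oapp (fun e => e :: path_edges y s) (path_edges y s) (edge_of x y).
Proof. by rewrite /path_edges /=; case: (edge_of x y). Qed.

Lemma mem_path_edges x s e : e \in path_edges x s ->
  e.1 \in x :: s /\ e.1 + unitv e.2 \in x :: s.
Proof.
elim: s x => [//|y s IH] x; rewrite path_edges_cons.
have IH' : e \in path_edges y s ->
    e.1 \in x :: y :: s /\ e.1 + unitv e.2 \in x :: y :: s.
  by move=> /IH [h1 h2]; split; rewrite in_cons ?h1 ?h2 orbT.
case E: (edge_of x y) => [f|//] /=.
rewrite in_cons => /orP[/eqP ->|//].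
by case: (edge_ofP _ _ _ E) => -[-> <-]; rewrite !in_cons !eqxx ?orbT.
Qed.

(** The first edge has [x] as an endpoint, whereas every later edge has both endpoints in [s], which
    avoids [x]. *)
Lemma uniq_path_edges x s : uniq (x :: s) -> uniq (path_edges x s).
Proof.
elim: s x => [//|y s IH] x /= /andP[xys uys]; rewrite path_edges_cons.
case E: (edge_of x y) => [f|] /=; last exact: IH.
rewrite IH // andbT; apply/negP => /mem_path_edges [h1 h2].
case: (edge_ofP _ _ _ E) => -[f1 fx].
  by move: h1; rewrite f1 (negPf xys).
by move: h2; rewrite f1 -fx (negPf xys).
Qed.

Lemma size_path_edges x s : (size (path_edges x s) <= size s)%N.
Proof.
elim: s x => [//|y s IH] x; rewrite path_edges_cons.
by case: (edge_of x y) => [e|] /=; [rewrite ltnS|apply: leqW]; exact: IH.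
Qed.

End PathEdges.

(** Used with [s1] the edges of a path, which are distinct, and [s2] a skeleton, whose overlapping
    regions repeat edges. *)
Lemma leq_count_subset (T : eqType) (a : pred T) (s1 s2 : seq T) :
  uniq s1 -> {subset s1 <= s2} -> (count a s1 <= count a (undup s2))%N.
Proof.
move=> u1 s12; rewrite -!size_filter uniq_leq_size ?filter_uniq // => x.
by rewrite !mem_filter mem_undup => /andP[-> /s12].
Qed.

(** * Covering a path by a chain of boxes *)

Section Skeleton.
Context {d : nat}.
Implicit Types (b x y u v : vertex d) (s : seq (vertex d)) (L K : nat).

(** Sup-norm distance, kept coordinatewise so that box indices can be compared one coordinate at a
    time. *)
Definition within L x y : Prop := forall i, `|y ord0 i - x ord0 i| <= L%:Z.

Lemma within_refl L x : within L x x.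
Proof. by move=> i; rewrite subrr normr0. Qed.

Lemma adj_within x y : adj x y -> within 1 x y.
Proof.
by case/existsP => i /orP[] /eqP -> j; rewrite !mxE eqxx /=;
  case: (j == i); rewrite ?mulr1n ?mulr0n; lia.
Qed.

Lemma path_within x s y : path (@adj d) x s -> y \in x :: s ->
  within (size s) x y.
Proof.
elim: s x => [|z s IH] x /=; first by rewrite inE => _ /eqP ->; exact: within_refl.
move=> /andP[/adj_within xz zs]; rewrite in_cons => /orP[/eqP ->|/(IH _ zs) zy] i.
  by rewrite subrr normr0.
by have := xz i; have := zy i; lia.
Qed.

(** A step changes a single coordinate by one, so the norm grows by at most one per step. *)
Lemma norm1_last_le s y : path (@adj d) 0 s -> last 0 s = y ->
  (norm1 y <= size s)%N.
Proof.
suff H x : path (@adj d) x s -> (norm1 (last x s) <= norm1 x + size s)%N.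
  move=> /H + <- => /leq_trans; apply.
  by rewrite /norm1 big1 // => i _; rewrite mxE.
elim: s x => [|z s IH] x /=; first by rewrite addn0.
move=> /andP[/existsP[i zx] /IH /leq_trans]; apply.
rewrite -addSnnS leq_add2r /norm1 (bigD1 i) //= [in leqRHS](bigD1 i) //=.
have -> : (\sum_(j < d | j != i) `|z ord0 j| = \sum_(j < d | j != i) `|x ord0 j|)%N.
  apply: eq_bigr => j ji; case/orP: zx => /eqP ->;
  by rewrite !mxE (negPf ji) andbF addr0.
rewrite -addSn leq_add2r; case/orP: zx => /eqP ->; rewrite !mxE !eqxx /=; lia.
Qed.

Definition box L x : vertex d := \row_i (x ord0 i %/ L%:Z)%Z.

(** The digits 0, 1, 2 of [a] encode the steps -1, 0, 1, so the chains with [K] steps form a finite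
    type of cardinality 3^(dK). *)
Definition shift b (a : {ffun 'I_d -> 'I_3}) : vertex d :=
  \row_i (b ord0 i + (a i : nat)%:Z - 1).

(** The block of 3^d boxes around [b] has lowest corner (b - 1)L and side 3L. Only the base point of
    an edge must lie in the block. *)
Definition region L b : seq (edge d) :=
  [seq (\row_i ((b ord0 i - 1) * L%:Z + (r i : nat)%:Z), k)
     | r : {ffun 'I_d -> 'I_(3 * L)} <- enum {ffun 'I_d -> 'I_(3 * L)},
       k : 'I_d <- enum 'I_d].

Fixpoint skeleton L b (p : seq {ffun 'I_d -> 'I_3}) : seq (edge d) :=
  region L b ++ if p is a :: p' then skeleton L (shift b a) p' else [::].

Lemma size_region L b : size (region L b) = ((3 * L) ^ d * d)%N.
Proof.
by rewrite size_allpairs -!cardE card_ffun !card_ord.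
Qed.

Lemma size_skeleton L b p :
  size (skeleton L b p) = ((size p).+1 * ((3 * L) ^ d * d))%N.
Proof.
elim: p b => [|a p IH] b /=; rewrite size_cat size_region /= ?addn0 ?mul1n //.
by rewrite IH -mulSn.
Qed.

(** If x lies in [bL, (b + 1)L) in some coordinate, then y lies in [(b - 1)L, (b + 2)L) there. *)
Lemma mem_region L x y k : (0 < L)%N -> within L x y ->
  (y, k) \in region L (box L x).
Proof.
move=> L0 xy.
have bnd i : (0 <= y ord0 i - (box L x ord0 i - 1) * L%:Z < (3 * L)%:Z)%R.
  have := xy i; rewrite mxE.
  have := divz_eq (x ord0 i) L%:Z.
  have : (0 <= (x ord0 i %% L%:Z)%Z < L%:Z)%R.
    by rewrite modz_ge0 ?ltz_pmod //; lia.
  move: (x ord0 i %% L%:Z)%Z (x ord0 i %/ L%:Z)%Z => m q; nia.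
have abs_lt i : (absz (y ord0 i - (box L x ord0 i - 1) * L%:Z)%R < 3 * L)%N.
  by have := bnd i; lia.
apply/allpairsP; exists ([ffun i => Ordinal (abs_lt i)], k); split;
  rewrite ?mem_enum //=.
congr pair; apply/rowP => i; rewrite [in RHS]mxE ffunE /=.
by have := bnd i; move: (y ord0 i) (box L x ord0 i); lia.
Qed.

Lemma box_shift L x y : (0 < L)%N -> within L x y ->
  exists a, box L y = shift (box L x) a.
Proof.
move=> L0 xy.
have bnd i : (absz (box L y ord0 i - box L x ord0 i + 1)%R < 3)%N /\
   (0 <= box L y ord0 i - box L x ord0 i + 1).
  have := xy i; rewrite !mxE.
  have := divz_eq (x ord0 i) L%:Z; have := divz_eq (y ord0 i) L%:Z.
  have : (0 <= (x ord0 i %% L%:Z)%Z < L%:Z)%R.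
    by rewrite modz_ge0 ?ltz_pmod //; lia.
  have : (0 <= (y ord0 i %% L%:Z)%Z < L%:Z)%R.
    by rewrite modz_ge0 ?ltz_pmod //; lia.
  move: (x ord0 i %% L%:Z)%Z (x ord0 i %/ L%:Z)%Z => m q.
  move: (y ord0 i %% L%:Z)%Z (y ord0 i %/ L%:Z)%Z => m' q' ? ? ? ? ?.
  (* The quotients differ by less than 2 because (q' - q)L is at most L plus a difference of
     remainders, hence below 2L; the other sign is symmetric. *)
  have ? : (q' - q - 2 < 0) by nia.
  have ? : (q' - q + 2 > 0) by nia.
  lia.
exists [ffun i => Ordinal (bnd i).1]; apply/rowP => i.
rewrite [in RHS]mxE ffunE /=; have := (bnd i).2.
by move: (box L y ord0 i) (box L x ord0 i); lia.
Qed.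

(** The first [L] steps stay within distance [L] of [x], hence in the region of its box. They end in
    the same or a neighbouring box, from which the induction continues with the remaining steps. *)
Lemma path_skeleton L K x s : (0 < L)%N -> path (@adj d) x s ->
  (size s <= K.+1 * L)%N ->
  exists p : K.-tuple {ffun 'I_d -> 'I_3},
    forall y k, y \in x :: s -> (y, k) \in skeleton L (box L x) p.
Proof.
move=> L0; elim: K x s => [|K IH] x s xs sK.
  exists [tuple] => y k ys /=; rewrite cats0; apply: mem_region => //.
  by move=> i; have := path_within _ _ _ xs ys i; lia.
have := xs; rewrite -(cat_take_drop L s) cat_path => /andP[xt td].
have wt y : y \in x :: take L s -> within L x y.
  move=> /(path_within _ _ _ xt) h i; have := h i.
  by rewrite size_take; case: ifP; lia.
have [a ba] := box_shift _ _ _ L0 (wt _ (mem_last x (take L s))).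
have [|p hp] := IH _ _ td; first by rewrite size_drop; lia.
exists [tuple of a :: p] => y k; rewrite /= -ba mem_cat -cat_cons mem_cat.
case/orP => [/wt wy|ys]; first by rewrite mem_region.
by rewrite hp ?orbT // in_cons ys orbT.
Qed.

Lemma count_path_skeleton L K y s (a : pred (edge d)) :
  (0 < L)%N -> is_spath 0 y s -> (size s <= K.+1 * L)%N ->
  exists p : K.-tuple {ffun 'I_d -> 'I_3},
    (count a (path_edges 0%R s) <= count a (undup (skeleton L 0%R p)))%N.
Proof.
move=> L0 /and3P[xs _ us] sK; have [p hp] := path_skeleton _ _ _ _ L0 xs sK.
(* All paths start at 0, so all chains start at the same box and only their steps have to be
   counted. *)
have box0 : box L 0 = 0 by apply/rowP => i; rewrite !mxE div0z.
exists p; apply: leq_count_subset; first exact: uniq_path_edges.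
by move=> [v k] /mem_path_edges [/hp + _]; rewrite box0; exact.
Qed.

End Skeleton.

(** * Measurability of the supremum over geodesics *)

Lemma measurable_ex_count {dO : measure_display} {T : measurableType dO}
  (I : countType) (F : I -> set T) :
  (forall i, measurable (F i)) -> measurable [set w | exists i, F i w].
Proof.
move=> mF; rewrite [X in measurable X](_ : _ = \bigcup_i F i).
  by apply: countable_bigcupT_measurable => //; exact: countableP.
by apply/seteqP; split=> w /= [i]; exists i.
Qed.

Lemma measurable_all_count {dO : measure_display} {T : measurableType dO}
  (I : countType) (F : I -> set T) :
  (forall i, measurable (F i)) -> measurable [set w | forall i, F i w].
Proof.
move=> mF; rewrite [X in measurable X](_ : _ = ~` [set w | exists i, (~` F i) w]).
  by apply: measurableC; apply: measurable_ex_count => i; exact: measurableC.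
apply/seteqP; split=> w /=; first by move=> h [i]; apply; exact: h.
by move=> /forallNP h i; apply: contrapT; exact: h.
Qed.

Lemma measurable_conj_prop {dO : measure_display} {T : measurableType dO}
  (Q : Prop) (F : set T) : measurable F -> measurable [set w | Q /\ F w].
Proof.
move=> mF; have [q|nq] := pselect Q.
  by rewrite [X in measurable X](_ : _ = F) //; apply/seteqP; split => w // -[].
by rewrite [X in measurable X](_ : _ = set0) //; apply/seteqP; split => w // -[].
Qed.

Lemma measurable_imp_prop {dO : measure_display} {T : measurableType dO}
  (Q : Prop) (F : set T) : measurable F -> measurable [set w | Q -> F w].
Proof.
move=> mF; have [q|nq] := pselect Q.
  rewrite [X in measurable X](_ : _ = F) //.
  by apply/seteqP; split => w /= h //; exact: h.
by rewrite [X in measurable X](_ : _ = setT) //; apply/seteqP; split => w //= _ /nq.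
Qed.

Section Measurability.
Context {R : realType} {d : nat} {dO : measure_display}
  {Omega : measurableType dO} (tau : edge d -> Omega -> R).
Hypothesis mtau : forall e, measurable_fun setT (tau e).
Implicit Types (B : set R) (w : Omega) (x : vertex d) (s : seq (vertex d)).

Lemma measurable_Tpath x s : measurable_fun setT (fun w => Tpath tau w x s).
Proof. by apply: measurable_sum => e; exact: mtau. Qed.

Lemma measurable_nu B s : measurable B ->
  measurable_fun setT (fun w => nu tau w B s).
Proof.
move=> mB; rewrite (_ : (fun w => _) = fun w =>
    (\sum_(e <- path_edges 0 s) \1_(tau e @^-1` B) w) * (size s)%:R^-1).
  apply: measurable_funM; last exact: measurable_cst.
  apply: measurable_sum => e; apply: measurable_indic.
  by rewrite -[X in measurable X]setTI; exact: mtau.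
apply/funext => w; rewrite /nu; congr (_ * _).
rewrite -sum1_count natr_sum big_mkcond /=; apply: eq_bigr => e _.
rewrite indicE (_ : `[< _ >] = (w \in tau e @^-1` B)); first by case: (_ \in _).
by apply/asboolP/idP; rewrite inE.
Qed.

Lemma nu_ge0 w B s : 0 <= nu tau w B s.
Proof. by rewrite /nu divr_ge0. Qed.

Lemma nu_le1 w B s : nu tau w B s <= 1.
Proof.
(* For the path without edges the quotient by 0 takes the value 0. *)
rewrite /nu; have [->|s0] := posnP (size s); first by rewrite invr0 mulr0.
rewrite ler_pdivrMr ?ltr0n // mul1r ler_nat.
exact: leq_trans (count_size _ _) (size_path_edges _ _).
Qed.

(* On the null event where a weight is negative the passage times may be
   unbounded below, and then the infimum [Tpp] takes the junk value 0. *)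
Lemma GeoP w x s : Geo tau w x s <-> is_spath 0 x s /\
  ((forall s', is_spath 0 x s' -> Tpath tau w 0 s <= Tpath tau w 0 s') \/
   (~ (exists n : nat, forall s', is_spath 0 x s' ->
         - n%:R <= Tpath tau w 0 s') /\ Tpath tau w 0 s = 0)).
Proof.
pose E := [set Tpath tau w 0 s' | s' in [set s' | is_spath 0 x s']].
(* Lower bounds of the form -n suffice, which turns boundedness into a countable condition. *)
have lbE : has_lbound E <-> exists n : nat, forall s', is_spath 0 x s' ->
    - n%:R <= Tpath tau w 0 s'.
  split=> [[y Ey]|[n hn]]; last by exists (- n%:R) => _ [s' ss' <-]; exact: hn.
  exists (Num.trunc `|y|).+1 => s' ss'.
  have : y <= Tpath tau w 0 s' by apply: Ey; exists s'.
  apply: le_trans; rewrite lerNl (le_trans (ler_norm _)) // normrN ltW //.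
  by have /andP[] := truncn_itv (normr_ge0 y).
rewrite /Geo /Tpp /= -/E; split=> -[ss h]; split => //.
  have [lb|nlb] := pselect (has_lbound E).
    by left => s' ss'; rewrite h; apply: (ge_inf lb); exists s'.
  right; split; first by move=> /lbE.
  by rewrite h inf_out // => -[].
have E0 : E !=set0 by exists (Tpath tau w 0 s); exists s.
case: h => [h|[nlb ->]]; last by rewrite inf_out // => -[_ /lbE].
have lbs : lbound E (Tpath tau w 0 s) by move=> _ [s' ss' <-]; exact: h.
by apply/eqP; rewrite eq_le lb_le_inf //= ge_inf //; [exists (Tpath tau w 0 s)|exists s].
Qed.

(** By [GeoP], being a geodesic is a countable combination of comparisons between finite sums of
    weights. *)
Lemma measurable_Geo x s : measurable [set w | Geo tau w x s].
Proof.
have mle (a b : Omega -> R) : measurable_fun setT a -> measurable_fun setT b ->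
    measurable [set w | a w <= b w].
  by move=> ma mb; have := measurable_fun_le measurableT ma mb; rewrite setTI.
under eq_set do rewrite (propext (GeoP _ _ _)).
apply: measurable_conj_prop; apply: measurableU.
  apply: measurable_all_count => s'; apply: measurable_imp_prop; apply: mle; exact: measurable_Tpath.
apply: measurableI.
  apply: measurableC; apply: measurable_ex_count => n.
  apply: measurable_all_count => s'; apply: measurable_imp_prop.
  by apply: mle; [exact: measurable_cst|exact: measurable_Tpath].
rewrite -[X in measurable X]setTI.
by apply: (measurable_Tpath 0 s measurableT [set 0]); exact: measurable_set1.
Qed.

Lemma sup_Geo_ge0 w B x : 0 <= sup [set nu tau w B s | s in Geo tau w x].
Proof.
have [[s Gs]|G0] := pselect (exists s, Geo tau w x s).
  apply: le_trans (nu_ge0 w B s) _; apply: ub_le_sup; last by exists s.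
  by exists 1 => _ [t _ <-]; exact: nu_le1.
by rewrite sup_out // => -[[_ [s Gs _]] _]; apply: G0; exists s.
Qed.

(** The condition 0 <= c covers the case of no geodesic, where the supremum of the empty set is
    0. *)
Lemma sup_Geo_le w B x c : 0 <= c ->
  (forall s, Geo tau w x s -> nu tau w B s <= c) ->
  sup [set nu tau w B s | s in Geo tau w x] <= c.
Proof.
move=> c0 h; have [[s Gs]|G0] := pselect (exists s, Geo tau w x s).
  by apply: ge_sup => [|_ [t Gt <-]]; [exists (nu tau w B s), s|exact: h].
by rewrite sup_out // => -[[_ [s Gs _]] _]; apply: G0; exists s.
Qed.

Hypothesis d_gt0 : (0 < d)%N.

(** Ensures that the outer supremum in [sup_nu] is over a nonempty set. *)
Lemma norm1_unbounded N : exists x : vertex d, (N <= norm1 x)%N.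
Proof.
exists (const_mx N%:Z); rewrite /norm1 (bigD1 (Ordinal d_gt0)) //=.
by rewrite mxE absz_nat leq_addr.
Qed.

Lemma sup_nu_le w B N c : 0 <= c ->
  (forall x s, (N <= norm1 x)%N -> Geo tau w x s -> nu tau w B s <= c) ->
  sup_nu tau B N w <= c.
Proof.
move=> c0 h; have [x Nx] := norm1_unbounded N.
apply: ge_sup => [|_ [y Ny <-]]; first by eexists; exists x.
by apply: sup_Geo_le => // s; exact: h.
Qed.

Lemma sup_nu_ge w B N x : (N <= norm1 x)%N ->
  sup [set nu tau w B s | s in Geo tau w x] <= sup_nu tau B N w.
Proof.
move=> Nx; apply: ub_le_sup; last by exists x.
exists 1 => _ [y _ <-]; apply: sup_Geo_le => // s _; exact: nu_le1.
Qed.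

Lemma sup_nu_ge0 w B N : 0 <= sup_nu tau B N w.
Proof.
have [x Nx] := norm1_unbounded N.
exact: le_trans (sup_Geo_ge0 _ _ _) (sup_nu_ge _ _ _ _ Nx).
Qed.

Lemma sup_nu_le1 w B N : sup_nu tau B N w <= 1.
Proof. by apply: sup_nu_le => // x s _ _; exact: nu_le1. Qed.

(** For c >= 0 the supremum exceeds c exactly when some geodesic does, a countable union over
    endpoints and paths. For c < 0 the event is the whole space. *)
Lemma measurable_sup_nu B N : measurable B -> measurable_fun setT (sup_nu tau B N).
Proof.
move=> mB; apply: (measurability _ (RGenOInfty.measurableE R)).
move=> _ [_ [c ->] <-]; rewrite setTI.
have [c0|c0] := ltP c 0.
  rewrite [X in measurable X](_ : _ = setT) //.
  apply/seteqP; split => w // _ /=; rewrite in_itv /= andbT.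
  exact: lt_le_trans c0 (sup_nu_ge0 _ _ _).
rewrite [X in measurable X](_ : _ = [set w | exists x, (N <= norm1 x)%N /\
   exists s, Geo tau w x s /\ c < nu tau w B s]).
  apply: measurable_ex_count => x; apply: measurable_conj_prop.
  apply: measurable_ex_count => s; apply: measurableI; first exact: measurable_Geo.
  rewrite [X in measurable X](_ : _ = [set w | nu tau w B s \in `]c, +oo[]).
    rewrite -[X in measurable X]setTI.
    by apply: (measurable_nu B s mB measurableT `]c, +oo[%classic); exact: measurable_itv.
  by apply/seteqP; split=> w /=; rewrite in_itv /= andbT.
apply/seteqP; split=> w /=; rewrite in_itv /= andbT.
  move=> cs; apply: contrapT => h; move: cs; apply/negP; rewrite -leNgt.
  apply: sup_nu_le => // x s Nx Gs; rewrite leNgt; apply/negP => cn.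
  by apply: h; exists x; split => //; exists s.
move=> [x [Nx [s [Gs cs]]]]; apply: lt_le_trans cs _.
apply: le_trans (sup_nu_ge _ _ _ _ Nx); apply: ub_le_sup; last by exists s.
by exists 1 => _ [t _ <-]; exact: nu_le1.
Qed.

End Measurability.

(** * Exponential tail for the number of occurring events *)

Section CountTail.
Context {R : realType} {dO : measure_display} {Omega : measurableType dO}
  (P : probability Omega R) (I : countType) (O : I -> set Omega) (p : R).
Hypothesis mO : forall i, measurable (O i).
Hypothesis p_ge0 : 0 <= p.
Hypothesis PO : forall s, uniq s ->
  P (\bigcap_(i in [set` s]) O i) = (p ^+ size s)%:E.

Let ncount w := count (fun i => `[< O i w >]).

(* The conditioning list [l] makes the statement inductive: Pascal's recursion
   moves the head of [s] into [l] when its event occurs. *)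
Lemma count_tail_cond (s l : seq I) (t : nat) : uniq (s ++ l) ->
  let E := [set w | (t <= ncount w s)%N /\ forall i, i \in l -> O i w] in
  measurable E /\
  (P E <= (p ^+ size l * (1 + 2 * p) ^+ size s / 2 ^+ t)%:E)%E.
Proof.
have mall l' : measurable [set w | forall i, i \in l' -> O i w].
  by apply: measurable_all_count => i; exact: measurable_imp_prop.
have x1 : 1 <= 1 + 2 * p by have := p_ge0; lra.
elim: s l t => [|e s IH] l [|t] /= ul.
- rewrite [X in measurable X](_ : _ = [set w | forall i, i \in l -> O i w]).
    split => //; rewrite [X in P X](_ : _ = \bigcap_(i in [set` l]) O i).
      by rewrite PO // expr0 mulr1 invr1 mulr1.
    by apply/seteqP; split=> w /=; [case|split].
  by apply/seteqP; split=> w /=; [case|split].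
- rewrite (_ : [set w | _] = set0); last by apply/seteqP; split=> w // [].
  split=> //; rewrite measure0 lee_fin mulr_ge0 // ?invr_ge0 ?exprn_ge0 //.
  by rewrite expr0 mulr1 exprn_ge0.
- have [_ ul'] := andP ul.
  rewrite [X in measurable X](_ : _ = [set w | forall i, i \in l -> O i w]).
    split => //; rewrite [X in P X](_ : _ = \bigcap_(i in [set` l]) O i).
      rewrite PO; last by move: ul'; rewrite cat_uniq => /and3P[].
      by rewrite lee_fin expr0 invr1 mulr1 ler_peMr ?exprn_ge0 ?exprn_ege1.
    by apply/seteqP; split=> w /=; [case|split].
  by apply/seteqP; split=> w /=; [case|split].
have [_ ul'] := andP ul.
have ul2 : uniq (s ++ e :: l) by rewrite (uniq_catCA s [:: e]).
have [m1 P1] := IH l t.+1 ul'; have [m2 P2] := IH (e :: l) t ul2.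
set E1 := (X in measurable X) in m1; set E2 := (X in measurable X) in m2.
(* If [O e] fails, all t + 1 occurrences come from [s]; if it holds, t of them do and [e] joins the
   conditioning list. *)
have -> : [set w | (t < `[< O e w >] + ncount w s)%N /\
    forall i, i \in l -> O i w] = E1 `|` E2.
  apply/seteqP; split=> w /=.
    case: asboolP => Oe [h hl]; last by left.
    right; split => // i; rewrite in_cons => /orP[/eqP -> //|]; exact: hl.
  case=> -[h hl]; split.
  - by rewrite (leq_trans h) // leq_addl.
  - by move=> i /hl.
  - by rewrite (_ : `[< O e w >] = true) //; apply/asboolP/hl; rewrite mem_head.
  - by move=> i il; apply: hl; rewrite in_cons il orbT.
split; first exact: measurableU.
apply: le_trans (measureU2 P m1 m2) _; apply: le_trans (leeD P1 P2) _.
rewrite -EFinD lee_fin /= !exprS.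
have t0 : (2 ^+ t : R) != 0 by rewrite expf_neq0 ?pnatr_eq0.
(* The two bounds add up exactly: 1 / 2^(t+1) + p / 2^t = (1 + 2p) / 2^(t+1). *)
by rewrite le_eqVlt; apply/orP; left; apply/eqP; field.
Qed.

(** A Markov bound for 2^count. The exact moment would give the base 1 + p; the recursion drops the
    factor 1 - p and gives 1 + 2p. *)
Lemma count_tail (s : seq I) (t : nat) : uniq s ->
  measurable [set w | (t <= ncount w s)%N] /\
  (P [set w | (t <= ncount w s)%N] <= ((1 + 2 * p) ^+ size s / 2 ^+ t)%:E)%E.
Proof.
move=> us; have := count_tail_cond s [::] t; rewrite cats0 => /(_ us) /=.
rewrite expr0 mul1r.
by rewrite (_ : [set w | _ /\ _] = [set w | (t <= ncount w s)%N]) //;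
  apply/seteqP; split=> w /=; [case|split].
Qed.

End CountTail.

(** * Union bound over chains of boxes *)

Lemma measure_bigsetU_le {R : realType} {dO : measure_display}
  {T : measurableType dO} (P : {measure set T -> \bar R}) (I : Type) (s : seq I)
  (F : I -> set T) : (forall i, measurable (F i)) ->
  (P (\big[setU/set0]_(i <- s) F i) <= \sum_(i <- s) P (F i))%E.
Proof.
move=> mF; elim: s => [|i s IH]; first by rewrite !big_nil measure0.
rewrite !big_cons; apply: le_trans (leeD2l _ IH).
by apply: measureU2 => //; exact: bigsetU_measurable.
Qed.

Section Heavy.
Context {R : realType} {d : nat} {dO : measure_display}
  {Omega : measurableType dO} (P : probability Omega R)
  (O : edge d -> set Omega) (p : R) (L M : nat).
Hypothesis mO : forall e, measurable (O e).
Hypothesis p_ge0 : 0 <= p.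
Hypothesis PO : forall s, uniq s ->
  P (\bigcap_(e in [set` s]) O e) = (p ^+ size s)%:E.

(** The bad event for chains of K + 1 boxes: some chain carries on average at least [M] occurrences
    per box. [undup] counts each edge once, as the tail bound requires. *)
Definition heavy (K : nat) : set Omega :=
  [set w | exists a : K.-tuple {ffun 'I_d -> 'I_3},
     (M * K.+1 <= count (fun e => `[< O e w >]) (undup (skeleton L 0%R a)))%N].

Lemma measurable_heavy K : measurable (heavy K).
Proof.
apply: measurable_ex_count => a.
exact: (count_tail P _ O p mO p_ge0 PO _ _ (undup_uniq _)).1.
Qed.

(** A fixed chain is bad with probability at most (exp(2A) / 2^M)^(K+1), and [M] is so large that
    this beats the number 3^(dK) of chains. *)
Lemma heavy_le K (A : R) : p * ((3 * L) ^ d * d)%:R <= A ->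
  2 * 3 ^+ d * expR (2 * A) <= 2 ^+ M ->
  (P (heavy K) <= (2^-1 ^+ K.+1)%:E)%E.
Proof.
move=> pA MA; pose F (a : K.-tuple {ffun 'I_d -> 'I_3}) : set Omega :=
  [set w | (M * K.+1 <= count (fun e => `[< O e w >]) (undup (skeleton L 0%R a)))%N].
have -> : heavy K = \big[setU/set0]_(a <- enum {: K.-tuple {ffun 'I_d -> 'I_3}}) F a.
  rewrite -bigcup_seq; apply/seteqP; split=> w /=.
    by move=> [a ha]; exists a => //=; rewrite mem_enum.
  by move=> [a _ ha]; exists a.
have FP a := count_tail P _ O p mO p_ge0 PO _ (M * K.+1) (undup_uniq (skeleton L 0%R a)).
have := measure_bigsetU_le P _ (enum {: K.-tuple {ffun 'I_d -> 'I_3}}) F (fun a => (FP a).1).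
move=> /le_trans; apply.
pose c : R := expR (2 * A) / 2 ^+ M.
have x1 : 1 <= 1 + 2 * p by have := p_ge0; lra.
have c0 : 0 <= c by rewrite divr_ge0 ?expR_ge0 ?exprn_ge0.
have Fc a : (P (F a) <= (c ^+ K.+1)%:E)%E.
  apply: le_trans (FP a).2 _; rewrite lee_fin exprM /c exprMn exprVn -exprM.
  rewrite ler_pM2r ?invr_gt0 ?exprn_gt0 //.
  apply: (@le_trans _ _ ((1 + 2 * p) ^+ (K.+1 * ((3 * L) ^ d * d)))).
    apply: ler_weXn2l => //; apply: leq_trans (size_undup _) _.
    by rewrite size_skeleton size_tuple.
  rewrite mulnC exprM lerXn2r ?nnegrE ?exprn_ge0 ?expR_ge0 //; first by have := p_ge0; lra.
  apply: (@le_trans _ _ (expR (2 * p) ^+ ((3 * L) ^ d * d))).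
    by rewrite lerXn2r ?nnegrE ?expR_ge0 ?expR_ge1Dx //; have := p_ge0; lra.
  by rewrite -expRM_natl ler_expR; move: pA; lra.
apply: (@le_trans _ _ (\sum_(a <- enum {: K.-tuple {ffun 'I_d -> 'I_3}}) (c ^+ K.+1)%:E)%E).
  by apply: lee_sum => a _; exact: Fc.
rewrite sumEFin lee_fin big_const_seq count_predT -cardE card_tuple card_ffun !card_ord.
rewrite iter_addr_0 -[leLHS]mulr_natl -expnM natrX.
apply: (@le_trans _ _ ((3 ^+ d) ^+ K.+1 * c ^+ K.+1)).
  by rewrite ler_wpM2r ?exprn_ge0 // -exprM ler_weXn2l ?ler1n // leq_mul.
have c3 : 0 <= 3 ^+ d * c by rewrite mulr_ge0 ?exprn_ge0.
rewrite -exprMn lerXn2r ?nnegrE ?invr_ge0 //.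
rewrite /c mulrA ler_pdivrMr ?exprn_gt0 //; move: MA; rewrite -mulrA; lra.
Qed.

End Heavy.

(** * Summation over chain lengths *)

Section HeavyTail.
Context {R : realType} {d : nat} {dO : measure_display}
  {Omega : measurableType dO} (P : probability Omega R)
  (O : edge d -> set Omega) (p : R) (L M : nat) (A : R).
Hypothesis mO : forall e, measurable (O e).
Hypothesis p_ge0 : 0 <= p.
Hypothesis PO : forall s, uniq s ->
  P (\bigcap_(e in [set` s]) O e) = (p ^+ size s)%:E.
Hypothesis pA : p * ((3 * L) ^ d * d)%:R <= A.
Hypothesis MA : 2 * 3 ^+ d * expR (2 * A) <= 2 ^+ M.

Definition heavy_from (K0 : nat) : set Omega := \bigcup_k heavy O L M (K0 + k).

Lemma measurable_heavy_from K0 : measurable (heavy_from K0).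
Proof.
by apply: bigcupT_measurable => k; exact: (measurable_heavy P O p).
Qed.

Lemma heavy_from_le K0 : (P (heavy_from K0) <= (2^-1 ^+ K0)%:E)%E.
Proof.
have mh k : measurable (heavy O L M (K0 + k)) by exact: (measurable_heavy P O p).
apply: le_trans (generalized_Boole_inequality P mh (measurable_heavy_from K0)) _.
(* The terms 2^-(K0+k+1) sum to 2^-K0. *)
apply: le_trans (epsilon_trick0 predT (exprn_ge0 K0 (_ : 0 <= 2^-1))).
  apply: lee_nneseries => // k _.
  apply: le_trans (heavy_le P O p L M mO p_ge0 PO _ A pA MA) _.
  by rewrite lee_fin -addnS exprD natrX -[in leRHS]exprVn.
by rewrite invr_ge0.
Qed.

End HeavyTail.

(** * Frequencies outside the bad event *)

Lemma box_side_exists {R : realType} (q : R) : 0 < q <= 1 ->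
  exists L : nat, 1 <= q * L%:R <= 2.
Proof.
(* This L lies between 1/q and 1/q + 1, so qL is between 1 and 1 + q <= 2. *)
move=> /andP[q0 q1]; exists (Num.trunc q^-1).+1.
have qV0 : 0 <= q^-1 by rewrite invr_ge0 ltW.
have /andP[h1 h2] := truncn_itv qV0.
have qq : q * q^-1 = 1 by rewrite mulfV // gt_eqF.
apply/andP; split; first by rewrite -[leLHS]qq ler_wpM2l ?(ltW q0) // ltW.
apply: (@le_trans _ _ (q * (q^-1 + 1))).
  by rewrite ler_wpM2l ?(ltW q0) // -natr1 lerD2r.
by rewrite mulrDr qq mulr1; lra.
Qed.

(** With K the quotient of the length n by L, the path fits in K + 1 boxes and has at most M(K + 1)
    <= 2MK edges in B, where K <= KqL <= qn. *)
Lemma nu_le_light {R : realType} {d : nat} {dO : measure_display}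
  {Omega : measurableType dO} (tau : edge d -> Omega -> R) (B : set R)
  (L M K0 : nat) (q : R) (w : Omega) (x : vertex d) (s : seq (vertex d)) :
  (0 < K0)%N -> (0 < L)%N -> 0 <= q -> 1 <= q * L%:R ->
  ~ heavy_from (fun e => tau e @^-1` B) L M K0 w ->
  (K0 * L <= norm1 x)%N -> is_spath 0 x s ->
  nu tau w B s <= 2 * M%:R * q.
Proof.
move=> K00 L0 q0 qL light Nx xs; pose n := size s; pose K := (n %/ L)%N.
have Kn : (K0 * L <= n)%N.
  have /and3P[ps /eqP ls _] := xs.
  exact: leq_trans Nx (norm1_last_le _ _ ps ls).
have K0K : (K0 <= K)%N by rewrite leq_divRL.
have nK : (n <= K.+1 * L)%N by rewrite ltnW // ltn_ceil.
have [a ha] := count_path_skeleton L K x s (fun e => `[< B (tau e w) >]) L0 xs nK.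
have cM : (count (fun e => `[< B (tau e w) >]) (path_edges 0%R s) <= M * K.+1)%N.
  apply: leq_trans ha _; rewrite leqNgt; apply/negP => h; apply: light.
  exists (K - K0)%N => //; rewrite subnKC //; exists a; exact: ltnW.
have n0 : (0 < n)%N by apply: leq_trans Kn; rewrite muln_gt0 K00.
rewrite /nu ler_pdivrMr ?ltr0n //.
have KLn : (K * L)%:R <= n%:R :> R by rewrite ler_nat leq_trunc_div.
(* K + 1 <= 2K because K >= K0 > 0. *)
apply: (@le_trans _ _ (2 * M%:R * K%:R)).
  rewrite -!natrM ler_nat (leq_trans cM) // -mulnA mulnCA leq_mul2l.
  by apply/orP; right; lia.
rewrite -[leRHS]mulrA ler_wpM2l ?mulr_ge0 //.
apply: le_trans (ler_wpM2l q0 KLn).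
by rewrite natrM mulrCA ler_peMr.
Qed.

(** * Choice of the constants and the two estimates *)

Theorem theorem2p4 (R : realType) (d : nat) (dO : measure_display)
  (Omega : measurableType dO) (P : probability Omega R)
  (mu : probability R R) (tau : edge d -> Omega -> R) :
  (2 <= d)%N ->
  (* i.i.d. weights with law mu *)
  (forall e, measurable_fun setT (tau e)) ->
  (forall e (A : set R), measurable A -> P (tau e @^-1` A) = mu A) ->
  iid_indep P tau ->
  (* non-negative weights *)
  mu `]-oo, 0[%classic = 0%E ->
  (* standing assumption *)
  (ess_inf_law mu = 0 -> distF mu (ess_inf_law mu) < @p_c R d) ->
  (0 < ess_inf_law mu -> distF mu (ess_inf_law mu) < @op_c R d) ->
  exists C7 C8 C9 C3' : R, [/\ 0 < C7, 0 < C8, 0 < C9, 0 < C3' &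
    forall B : set R, measurable B -> (0 < mu B)%E ->
    exists N : nat,
      (forall s : R, C7 < s ->
        (P [set w | (s * (fine (mu B) `^ (d%:R^-1)) < sup_nu tau B N w)%R]
          <= (C8 * expR (- (C9 * s)))%:E)%E) /\
      (\int[P]_w (sup_nu tau B N w)%:E <= (C3' * fine (mu B) `^ (d%:R^-1))%:E)%E].
Proof.
move=> d2 mtau law indep _ _ _.
have d0 : (0 < d)%N by apply: leq_trans d2.
(* [A] bounds the mean number of B-edges per region: p(3L)^d = (3qL)^d <= 6^d. Both [A] and [M]
   depend on d alone. *)
pose A : R := (6 ^ d * d)%:R.
pose M := (Num.bound (2 * 3 ^+ d * expR (2 * A))).+1.
have MA : 2 * 3 ^+ d * expR (2 * A) <= 2 ^+ M by apply/ltW/upper_nthrootP.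
have M0 : 0 < M%:R :> R by rewrite ltr0n.
(* Outside the bad event the frequency is at most 2Mq; the extra 1 in the last constant pays for the
   bad event, of probability at most q. *)
exists (2 * M%:R), 1, 1, (2 * M%:R + 1); split => //; try by lra.
move=> B mB muB0; set p := fine (mu B); set q := p `^ _.
have pE : mu B = p%:E by rewrite /p fineK // fin_num_measure.
have p0 : 0 < p by rewrite -lte_fin -pE.
have p1 : p <= 1 by rewrite -lee_fin -pE; exact: probability_le1.
have q0 : 0 < q by rewrite powR_gt0.
have qd : q ^+ d = p.
  rewrite /q -powR_mulrn ?powR_ge0 // -powRrM mulVf ?powRr1 ?(ltW p0) //.
  by rewrite pnatr_eq0 -lt0n.
have q1 : q <= 1.
  rewrite leNgt; apply/negP => q1; move: p1; rewrite leNgt -qd.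
  by rewrite exprn_egt1 // -lt0n d0.
have [|L /andP[qL1 qL2]] := box_side_exists q; first by rewrite q0.
have L0 : (0 < L)%N.
  by rewrite lt0n; apply: contraTneq qL1 => ->; rewrite mulr0 ler10.
have pA : p * ((3 * L) ^ d * d)%:R <= A.
  rewrite /A !natrM mulrA ler_wpM2r // !natrX natrM exprMn mulrCA -qd -exprMn.
  have h6 : 6 = 3 * 2 :> R by ring.
  rewrite h6 [(3 * 2) ^+ d]exprMn.
  by rewrite ler_wpM2l ?exprn_ge0 // lerXn2r ?nnegrE // (le_trans _ qL1).
pose O e := tau e @^-1` B.
have mO e : measurable (O e) by rewrite -[X in measurable X]setTI; exact: mtau.
have PO s : uniq s -> P (\bigcap_(e in [set` s]) O e) = (p ^+ size s)%:E.
  move=> us; rewrite (indep s us (fun=> B)) //.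
  rewrite (eq_bigr (fun=> p%:E)); last by move=> e _; rewrite law.
  by rewrite prodEFin big_const_seq count_predT iter_mulr_1.
(* Here 2^K0 >= exp(1/q); the successor makes K0 positive. *)
pose K0 := (Num.bound (expR q^-1)).+1.
have K0q : 2^-1 ^+ K0 <= expR (- q^-1) :> R.
  rewrite exprVn expRN lef_pV2 ?posrE ?expR_gt0 ?exprn_gt0 //.
  by apply/ltW/upper_nthrootP.
have expq : expR (- q^-1) <= q.
  rewrite expRN invf_ple ?posrE ?expR_gt0 //.
  by apply: le_trans (expR_ge1Dx _); rewrite lerDr.
pose H := heavy_from O L M K0.
have mH : measurable H by exact: (measurable_heavy_from P O p L M mO (ltW p0) PO).
have PH : (P H <= (expR (- q^-1))%:E)%E.
  apply: le_trans (heavy_from_le P O p L M A mO (ltW p0) PO pA MA K0) _.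
  by rewrite lee_fin.
exists (K0 * L)%N.
have msup := measurable_sup_nu tau mtau d0 B (K0 * L) mB.
have light w : ~ H w -> sup_nu tau B (K0 * L) w <= 2 * M%:R * q.
  move=> nH; apply: sup_nu_le => //; first by rewrite mulr_ge0 ?(ltW q0) // ltW // mulr_gt0.
  move=> x s Nx [xs _]; exact: (nu_le_light _ _ _ _ K0 _ _ x _ _ L0 (ltW q0) qL1).
split=> [s Ms|].
  have [sq|sq] := leP 1 (s * q).
    rewrite [X in P X](_ : _ = set0) ?measure0 ?lee_fin ?mulr_ge0 ?expR_ge0 //.
    apply/seteqP; split=> w //=; rewrite ltNge => /negP; apply.
    exact: le_trans (sup_nu_le1 _ d0 _ _ _) sq.
  (* As s > 2M, the event is contained in [H], and s < 1/q gives P(H) <= exp(-1/q) <= exp(-s). *)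
  apply: (@le_trans _ _ (P H)).
    apply: le_measure; rewrite ?inE //.
      rewrite [X in measurable X](_ : _ = sup_nu tau B (K0 * L) @^-1` `]s * q, +oo[%classic).
        by rewrite -[X in measurable X]setTI; apply: msup => //; exact: measurable_itv.
      by apply/seteqP; split=> w /=; rewrite in_itv /= andbT.
    move=> w /= sw; apply: contrapT => /light; apply/negP; rewrite -ltNge.
    by apply: le_lt_trans sw; rewrite ler_wpM2r ?(ltW q0) // ltW.
  apply: le_trans PH _; rewrite lee_fin !mul1r ler_expR lerN2.
  by rewrite -[leRHS]mul1r ler_pdivlMr // ltW.
(* The supremum is at most 2Mq off [H] and at most 1 on [H]. *)
apply: (@le_trans _ _ (\int[P]_w ((2 * M%:R * q)%:E + (\1_H w)%:E))%E).
  apply: ge0_le_integral => //.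
  - by move=> w _; rewrite lee_fin sup_nu_ge0.
  - exact/measurable_EFinP.
  - apply: emeasurable_funD; first exact: measurable_cst.
    by apply/measurable_EFinP; exact: measurable_indic.
  - move=> w _; rewrite -EFinD lee_fin indicE.
    have [/set_mem Hw|/negP] := boolP (w \in H).
      apply: le_trans (sup_nu_le1 _ d0 _ _ _) _.
      by rewrite lerDr mulr_ge0 ?(ltW q0) // ltW // mulr_gt0.
    by rewrite addr0 => nH; apply: light => Hw; apply: nH; rewrite inE.
rewrite ge0_integralD //; first last.
- by apply/measurable_EFinP; exact: measurable_indic.
- by move=> w _; rewrite lee_fin.
- by move=> w _; rewrite lee_fin mulr_ge0 ?(ltW q0) // ltW // mulr_gt0.
rewrite integral_cst // integral_indic // setIT.
rewrite [X in (_ * X + _)%E]probability_setT mule1 [in leRHS]mulrDl mul1r EFinD.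
by rewrite leeD2l // (le_trans PH) // lee_fin.
Qed.
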